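(* Let $k\ge2$ and let $(f_h^n,E_h^n)_{n\ge0}$ be produced by the split discontinuous Galerkin (DG) scheme $\textbf{Scheme-4}(\Delta t)$ or $\textbf{Scheme-4F}(\Delta t)$ for the 1D1V Vlasov–Ampère system (defined in the context), with either upwind or central fluxes. Then the discrete total energy is preserved, $TE_n=TE_{n+1}$, where $$2\,TE_n=\int_{\Omega_x}\int_{\Omega_v}f_h^n|v|^2\,dv\,dx+\int_{\Omega_x}|E_h^n|^2\,dx .$$
   Context: The 1D1V Vlasov–Ampère system is $\partial_tf+vf_x+Ef_v=0$, $\partial_tE=-J$, $J(x,t)=\int_{\Omega_v}f\,v\,dv$, on $\Omega_x\times\Omega_v=[0,L]\times[-V_c,V_c]$, periodic in $x$. Standing assumption: $V_c$ is so large that all numerical approximations of $f$ (including intermediate ones) vanish at $v=\pm V_c$ (zero traces, exterior value zero), so all numerical fluxes at $v=\pm V_c$ vanish. Grid: $0=x_{1/2}<\dots<x_{N_x+1/2}=L$, $-V_c=v_{1/2}<\dots<v_{N_v+1/2}=V_c$, $K_{x,i}=[x_{i-1/2},x_{i+1/2}]$, $K_{v,j}=[v_{j-1/2},v_{j+1/2}]$. For integer $k\ge0$: $x_i^{(l)}$ ($l=1,\dots,k+1$) and $v_j^{(m)}$ ($m=1,\dots,k+1$) are the $(k+1)$ Gauss quadrature points on $K_{x,i}$ and $K_{v,j}$ (the rule is exact for degree at most $2k+1$). Spaces: $\mathcal W_h^k$ (resp. $\mathcal Z_h^k$) consists of functions on $\Omega_x$ (resp. $\Omega_v$) that are polynomials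 of degree at most $k$ on each $K_{x,i}$ (resp. $K_{v,j}$); $\mathcal S_h^k$ consists of functions on $\Omega_x\times\Omega_v$ whose restriction to each $K_{x,i}\times K_{v,j}$ lies in the tensor product $P^k(K_{x,i})\otimes P^k(K_{v,j})$. Data: $f_h^0\in\mathcal S_h^k$, $E_h^0\in\mathcal W_h^k$. Superscripts $\pm$ denote right/left limits at grid points. Numerical fluxes: for a constant $c$ and a piecewise polynomial $g$, $\widehat{cg}$ at a grid point is either central, $\frac c2(g^++g^-)$, or upwind, $\frac c2(g^++g^-)-\frac{|c|}2(g^+-g^-)$. For negative time steps the upwind flux is replaced by the downwind flux (opposite sign of the jump term). $\textbf{Scheme-a}(\tau)$, mapping $(f_h^{\rm old},E_h^{\rm old})$ to $(f_h^{\rm new},E_h^{\rm new})$: for each $j,m$ find $g_j^{(m)}\in\mathcal W_h^k$ such that, with $\bar g(x)=\frac12\big(g_j^{(m)}(x)+f_h^{\rm old}(x,v_j^{(m)})\big)$, for all $i$ and all $\varphi\in\mathcal W_h^k$, $$\int_{K_{x,i}}\frac{g_j^{(m)}(x)-f_h^{\rm old}(x,v_j^{(m)})}{\tau}\varphi\,dx-\int_{K_{x,i}}v_j^{(m)}\bar g\,\varphi_x\,dx+\big(\widehat{v_j^{(m)}\bar g}\big)_{i+1/2}\varphi^-_{i+1/2}-\big(\widehat{v_j^{(m)}\bar g}\big)_{i-1/2}\varphi^+_{i-1/2}=0 .$$ Then $f_h^{\rm new}\in\mathcal S_h^k$ is the unique element with $f_h^{\rm new}(x_i^{(l)},v_j^{(m)})=g_j^{(m)}(x_i^{(l)})$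 for all $i,j,l,m$, and $E_h^{\rm new}=E_h^{\rm old}$. $\textbf{Scheme-b}(\tau)$: for each $i,l$ find $g_i^{(l)}\in\mathcal Z_h^k$ and $E_i^{(l)}\in\mathbb R$ such that, with $\bar g(v)=\frac12\big(g_i^{(l)}(v)+f_h^{\rm old}(x_i^{(l)},v)\big)$ and $\bar E=\frac12\big(E_h^{\rm old}(x_i^{(l)})+E_i^{(l)}\big)$, for all $j$ and all $\varphi\in\mathcal Z_h^k$, $$\int_{K_{v,j}}\frac{g_i^{(l)}(v)-f_h^{\rm old}(x_i^{(l)},v)}{\tau}\varphi\,dv-\int_{K_{v,j}}\bar E\,\bar g\,\varphi_v\,dv+\big(\widehat{\bar E\bar g}\big)_{j+1/2}\varphi^-_{j+1/2}-\big(\widehat{\bar E\bar g}\big)_{j-1/2}\varphi^+_{j-1/2}=0,$$ $$\frac{E_i^{(l)}-E_h^{\rm old}(x_i^{(l)})}{\tau}=-\tfrac12\big(J_h^{\rm old}(x_i^{(l)})+J_i^{(l)}\big),\quad J_h^{\rm old}(x)=\int_{\Omega_v}f_h^{\rm old}(x,v)v\,dv,\quad J_i^{(l)}=\int_{\Omega_v}g_i^{(l)}(v)v\,dv .$$ Then $f_h^{\rm new}\in\mathcal S_h^k$ and $E_h^{\rm new}\in\mathcal W_h^k$ are the unique elements with $f_h^{\rm new}(x_i^{(l)},v_j^{(m)})=g_i^{(l)}(v_j^{(m)})$ and $E_h^{\rm new}(x_i^{(l)})=E_i^{(l)}$ for all $i,j,l,m$. $\textbf{Scheme-4}(\tau)=\textbf{Scheme-a}(\tau/2)\,\textbf{Scheme-b}(\tau)\,\textbf{Scheme-a}(\tau/2)$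 and $\textbf{Scheme-4F}(\tau)=\textbf{Scheme-4}(\beta_1\tau)\,\textbf{Scheme-4}(\beta_2\tau)\,\textbf{Scheme-4}(\beta_3\tau)$ (compositions), with $\beta_1=\beta_3=(2+2^{1/3}+2^{-1/3})/3$, $\beta_2=1-2\beta_1<0$. Since the schemes are implicit, any sequence satisfying the equations is meant. *)

(* Defs.v *)
From HB Require Import structures.
From mathcomp Require Import all_boot all_order all_algebra.
From mathcomp Require Import all_classical all_reals all_analysis.

Set Implicit Arguments.
Unset Strict Implicit.
Unset Printing Implicit Defensive.

Import Order.TTheory GRing.Theory Num.Theory.
Import numFieldNormedType.Exports.

Local Open Scope classical_set_scope.
Local Open Scope ring_scope.

(* The (k+1)-point Gauss rule on [a, b]: distinct nodes in the cell for which
   suitable weights make the rule exact up to degree 2k+1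
   (recall that size p is the degree plus one). *)
Definition gauss_points (R : realType) (k : nat) (a b : R)
    (xi : 'I_k.+1 -> R) : Prop :=
  [/\ injective xi,
      forall l, a <= xi l <= b
    & exists w : 'I_k.+1 -> R, forall p : {poly R}, (size p <= 2 * k + 2)%N ->
        \int[lebesgue_measure]_(x in `[a, b]) p.[x]
          = \sum_(l < k.+1) w l * p.[xi l]].

(* A grid a = edge 0 < ... < edge N = b with the Gauss points of its cells.
   Cells are numbered from 0: cell i is [edge i, edge i.+1].  The values of
   edge beyond index N are irrelevant. *)
Record grid (R : realType) (k : nat) (a b : R) := Grid {
  ncells : nat;
  edge : nat -> R;
  node : 'I_ncells -> 'I_k.+1 -> R;
  edge_first : edge 0%N = a;
  edge_last : edge ncells = b;
  edge_lt : forall i : 'I_ncells, edge i < edge i.+1;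
  node_gauss : forall i : 'I_ncells,
    gauss_points (edge i) (edge i.+1) (@node i)
}.
Arguments node {R k a b} _ _ _.

Definition cell (R : realType) (k : nat) (a b : R) (m : grid k a b)
    (i : 'I_(ncells m)) : set R := `[edge m i, edge m i.+1].

(* Piecewise polynomials are given by one polynomial per cell: they are
   two-valued at the grid points.  Accordingly, an integral over the whole
   interval is the sum of the integrals over the cells. *)
Definition pwpoly (R : realType) (k : nat) (a b : R) (m : grid k a b) : Type :=
  'I_(ncells m) -> {poly R}.

Definition in_space (R : realType) (k : nat) (a b : R) (m : grid k a b)
    (g : pwpoly m) : Prop := forall i, (size (g i) <= k.+1)%N.

Definition integral_over (R : realType) (k : nat) (a b : R) (m : grid k a b)
    (F : 'I_(ncells m) -> R -> R) : R :=
  \sum_(i < ncells m) \int[lebesgue_measure]_(x in cell i) F i x.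

Definition average (R : realType) (k : nat) (a b : R) (m : grid k a b)
    (g h : pwpoly m) : pwpoly m := fun i => 2^-1 *: (g i + h i).

(* Limits at the ends of cell i taken from inside the cell. *)
Definition inner_left (R : realType) (k : nat) (a b : R) (m : grid k a b)
    (g : pwpoly m) (i : 'I_(ncells m)) : R := (g i).[edge m i].
Definition inner_right (R : realType) (k : nat) (a b : R) (m : grid k a b)
    (g : pwpoly m) (i : 'I_(ncells m)) : R := (g i).[edge m i.+1].

(* Limits at the ends of cell i taken from outside the cell: periodic
   extension in x (ordS and ord_pred are cyclic), zero exterior value in v. *)
Inductive boundary := Periodic | ZeroExterior.

Definition outer_left (R : realType) (k : nat) (a b : R) (m : grid k a b)
    (bc : boundary) (g : pwpoly m) (i : 'I_(ncells m)) : R :=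
  match bc with
  | Periodic => inner_right g (ord_pred i)
  | ZeroExterior =>
      if val i == 0%N then 0 else inner_right g (ord_pred i)
  end.
Definition outer_right (R : realType) (k : nat) (a b : R) (m : grid k a b)
    (bc : boundary) (g : pwpoly m) (i : 'I_(ncells m)) : R :=
  match bc with
  | Periodic => inner_left g (ordS i)
  | ZeroExterior =>
      if i.+1 == ncells m then 0 else inner_left g (ordS i)
  end.

Inductive flux_kind := Central | Upwind.

(* gm and gp are the left and right limits.  For tau < 0 the upwind flux turns
   into the downwind one. *)
Definition numflux (R : realType) (fk : flux_kind) (tau c gm gp : R) : R :=
  match fk with
  | Central => c / 2 * (gp + gm)
  | Upwind => c / 2 * (gp + gm) - Num.sg tau * (`|c| / 2 * (gp - gm))
  end.

(* One implicit midpoint DG step, of size tau, for g_t + c g_y = 0. *)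
Definition dg_step (R : realType) (k : nat) (a b : R) (m : grid k a b)
    (bc : boundary) (fk : flux_kind) (tau c : R) (gold gnew : pwpoly m) : Prop :=
  let gbar := average gnew gold in
  forall (i : 'I_(ncells m)) (phi : pwpoly m), in_space phi ->
    \int[lebesgue_measure]_(y in cell i)
        (((gnew i).[y] - (gold i).[y]) / tau * (phi i).[y])
    - \int[lebesgue_measure]_(y in cell i)
        (c * (gbar i).[y] * ((phi i)^`()).[y])
    + numflux fk tau c (inner_right gbar i) (outer_right bc gbar i)
        * inner_right phi i
    - numflux fk tau c (outer_left bc gbar i) (inner_left gbar i)
        * inner_left phi i
    = 0.

(* Functions on the product grid.  In polyXY's notation u.[x, v] is
   u.[x%:P].[v]: the outer variable of {poly {poly R}} is x, and sizeY is the
   size in v. *)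
Definition pwpoly2 (R : realType) (k : nat) (L Vc : R)
    (mx : grid k 0 L) (mv : grid k (- Vc) Vc) : Type :=
  'I_(ncells mx) -> 'I_(ncells mv) -> {poly {poly R}}.

Definition in_space2 (R : realType) (k : nat) (L Vc : R)
    (mx : grid k 0 L) (mv : grid k (- Vc) Vc) (f : pwpoly2 mx mv) : Prop :=
  forall i j, (size (f i j) <= k.+1)%N /\ (sizeY (f i j) <= k.+1)%N.

(* The functions f(., v), for v in cell j, and f(x, .), for x in cell i. *)
Definition fix_v (R : realType) (k : nat) (L Vc : R)
    (mx : grid k 0 L) (mv : grid k (- Vc) Vc) (f : pwpoly2 mx mv)
    (j : 'I_(ncells mv)) (v : R) : pwpoly mx :=
  fun i => (swapXY (f i j)).[v%:P].
Definition fix_x (R : realType) (k : nat) (L Vc : R)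
    (mx : grid k 0 L) (mv : grid k (- Vc) Vc) (f : pwpoly2 mx mv)
    (i : 'I_(ncells mx)) (x : R) : pwpoly mv :=
  fun j => (f i j).[x%:P].

Definition zero_trace (R : realType) (k : nat) (Vc : R)
    (mv : grid k (- Vc) Vc) (g : pwpoly mv) : Prop :=
  forall j : 'I_(ncells mv),
    (val j = 0%N -> inner_left g j = 0) /\
    (j.+1 = ncells mv -> inner_right g j = 0).

Definition zero_trace2 (R : realType) (k : nat) (L Vc : R)
    (mx : grid k 0 L) (mv : grid k (- Vc) Vc) (f : pwpoly2 mx mv) : Prop :=
  forall (i : 'I_(ncells mx)) (x : R), cell i x -> zero_trace (fix_x f i x).

Definition current (R : realType) (k : nat) (Vc : R)
    (mv : grid k (- Vc) Vc) (g : pwpoly mv) : R :=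
  integral_over (fun j v => (g j).[v] * v).

Record state (R : realType) (k : nat) (L Vc : R)
    (mx : grid k 0 L) (mv : grid k (- Vc) Vc) := State {
  st_f : pwpoly2 mx mv;
  st_E : pwpoly mx
}.

(* The standing assumption on V_c is the clause zero_trace2 here, together with
   the clause zero_trace on the implicit unknowns of scheme_b: it is imposed on
   every approximation of f, intermediate ones included, since the schemes
   below only produce admissible states. *)
Definition admissible (R : realType) (k : nat) (L Vc : R)
    (mx : grid k 0 L) (mv : grid k (- Vc) Vc) (s : state mx mv) : Prop :=
  [/\ in_space2 (st_f s), zero_trace2 (st_f s) & in_space (st_E s)].

Definition scheme_a (R : realType) (k : nat) (L Vc : R)
    (mx : grid k 0 L) (mv : grid k (- Vc) Vc) (fkx : flux_kind) (tau : R)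
    (old new : state mx mv) : Prop :=
  exists g : 'I_(ncells mv) -> 'I_k.+1 -> pwpoly mx,
    [/\ forall j m, in_space (g j m),
        forall j m, dg_step Periodic fkx tau (node mv j m)
                      (fix_v (st_f old) j (node mv j m)) (g j m),
        admissible new,
        forall i j l m, (st_f new i j).[node mx i l, node mv j m]
                        = (g j m i).[node mx i l]
      & st_E new = st_E old].

Definition scheme_b (R : realType) (k : nat) (L Vc : R)
    (mx : grid k 0 L) (mv : grid k (- Vc) Vc) (fkv : flux_kind) (tau : R)
    (old new : state mx mv) : Prop :=
  exists (g : 'I_(ncells mx) -> 'I_k.+1 -> pwpoly mv)
         (Eg : 'I_(ncells mx) -> 'I_k.+1 -> R),
    (forall i l, let x := node mx i l in
      [/\ in_space (g i l),
          zero_trace (g i l),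
          dg_step ZeroExterior fkv tau (2^-1 * ((st_E old i).[x] + Eg i l))
            (fix_x (st_f old) i x) (g i l)
        & (Eg i l - (st_E old i).[x]) / tau
          = - (2^-1 * (current (fix_x (st_f old) i x) + current (g i l)))]) /\
    [/\ admissible new,
        forall i j l m, (st_f new i j).[node mx i l, node mv j m]
                        = (g i l j).[node mv j m]
      & forall i l, (st_E new i).[node mx i l] = Eg i l].

Definition scheme4 (R : realType) (k : nat) (L Vc : R)
    (mx : grid k 0 L) (mv : grid k (- Vc) Vc) (fkx fkv : flux_kind) (tau : R)
    (old new : state mx mv) : Prop :=
  exists s1 s2 : state mx mv,
    [/\ scheme_a fkx (tau / 2) old s1,
        scheme_b fkv tau s1 s2
      & scheme_a fkx (tau / 2) s2 new].

Definition beta1 (R : realType) : R :=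
  (2 + 2 `^ (3^-1) + 2 `^ (- 3^-1)) / 3.
Definition beta2 (R : realType) : R := 1 - 2 * beta1 R.

Definition scheme4F (R : realType) (k : nat) (L Vc : R)
    (mx : grid k 0 L) (mv : grid k (- Vc) Vc) (fkx fkv : flux_kind) (tau : R)
    (old new : state mx mv) : Prop :=
  exists s1 s2 : state mx mv,
    [/\ scheme4 fkx fkv (beta1 R * tau) old s1,
        scheme4 fkx fkv (beta2 R * tau) s1 s2
      & scheme4 fkx fkv (beta1 R * tau) s2 new].

Definition total_energy (R : realType) (k : nat) (L Vc : R)
    (mx : grid k 0 L) (mv : grid k (- Vc) Vc) (s : state mx mv) : R :=
  2^-1 * (integral_over (fun i x =>
            integral_over (fun j v => (st_f s i j).[x, v] * `|v| ^+ 2))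
          + integral_over (fun i x => `|(st_E s i).[x]| ^+ 2)).

(* Main.v *)
(* Every integrand in the energy and in the tested equations has degree at most
   2k+1 in each variable, so all integrals may be replaced by Gauss quadrature,
   which only sees the values at the nodes transported by the schemes.  Testing
   Scheme-a with 1 shows that it preserves the x-mass at each node v_j^(m), hence
   the kinetic energy.  Testing Scheme-b with v^2 (here k >= 2 is needed) gives,
   at each node x_i^(l),
     K' - K = tau Ebar (J + J')  and  E'^2 - E^2 = 2 Ebar (E' - E) = - tau Ebar (J + J'),
   where K is the integral of f v^2 dv. *)
Require Import Defs.
From mathcomp Require Import all_boot all_order all_algebra.
From mathcomp Require Import all_classical all_reals all_analysis.
From mathcomp Require Import zify ring lra.

Set Implicit Arguments.
Unset Strict Implicit.
Unset Printing Implicit Defensive.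

Import Order.TTheory GRing.Theory Num.Theory.
Local Open Scope ring_scope.

(** * Gauss quadrature on a one-dimensional grid *)

Section GridQuadrature.
Variables (R : realType) (k : nat) (a b : R) (m : grid k a b).
Implicit Types (g : pwpoly m) (p phi : {poly R}).

Definition gauss_weights (w : 'I_(ncells m) -> 'I_k.+1 -> R) : Prop :=
  forall i p, (size p <= 2 * k + 2)%N ->
    \int[lebesgue_measure]_(y in cell i) p.[y]
      = \sum_(l < k.+1) w i l * p.[node m i l].

Lemma gauss_weights_exist : exists w, gauss_weights w.
Proof.
have [w wP] := choice (fun i : 'I_(ncells m) =>
  let: And3 _ _ e := node_gauss i in e).
by exists w => i; apply: wP.
Qed.

Variables (w : 'I_(ncells m) -> 'I_k.+1 -> R) (wP : gauss_weights w).

(** The form of an integral after quadrature: it sees [F] only at the nodes, whose values the split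
    steps hand on to each other. *)
Definition quad (F : 'I_(ncells m) -> R -> R) : R :=
  \sum_(i < ncells m) \sum_(l < k.+1) w i l * F i (node m i l).

Lemma quadD F G : quad (fun i y => F i y + G i y) = quad F + quad G.
Proof.
rewrite -big_split; apply: eq_bigr => i _.
by rewrite -big_split; apply: eq_bigr => l _; rewrite mulrDr.
Qed.

Lemma quadZ c F : quad (fun i y => c * F i y) = c * quad F.
Proof.
rewrite mulr_sumr; apply: eq_bigr => i _.
by rewrite mulr_sumr; apply: eq_bigr => l _; rewrite mulrCA.
Qed.

Lemma eq_quad F G :
  (forall i l, F i (node m i l) = G i (node m i l)) -> quad F = quad G.
Proof. by move=> FG; do 2![apply: eq_bigr => ? _]; rewrite FG. Qed.

(** Admissibility gives zero traces for [x] inside a cell; this makes it applicable at the nodes. *)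
Lemma cell_node i l : cell i (node m i l).
Proof. by case: (node_gauss i) => _ /(_ l) ? _; rewrite /cell /= in_itv. Qed.

Lemma sum_integral_quad (F : 'I_(ncells m) -> R -> R) (P : pwpoly m) :
  (forall i, size (P i) <= 2 * k + 2)%N -> (forall i y, F i y = (P i).[y]) ->
  \sum_i \int[lebesgue_measure]_(y in cell i) F i y = quad F.
Proof.
move=> sP FP; apply: eq_bigr => i _.
by under eq_Rintegral do rewrite FP; rewrite wP //; apply: eq_bigr => l _; rewrite FP.
Qed.

Definition right_flux bc fk (tau c : R) g i : R :=
  numflux fk tau c (inner_right g i) (outer_right bc g i).
Definition left_flux bc fk (tau c : R) g i : R :=
  numflux fk tau c (outer_left bc g i) (inner_left g i).

(* [phi] is a single polynomial on all of [a, b], hence continuous across the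
   interior grid points. *)
Lemma dg_step_quad bc fk tau c (gold gnew : pwpoly m) phi :
  tau != 0 -> in_space gold -> in_space gnew -> (size phi <= k.+1)%N ->
  dg_step bc fk tau c gold gnew ->
  \sum_i right_flux bc fk tau c (average gnew gold) i * phi.[edge m i.+1]
    = \sum_i left_flux bc fk tau c (average gnew gold) i * phi.[edge m i] ->
  quad (fun i y => ((gnew i).[y] - (gold i).[y]) * phi.[y])
    = tau * (c * quad (fun i y => (average gnew gold i).[y] * phi^`().[y])).
Proof.
move=> tau0 sold snew sphi step flux.
(* A product of two polynomials of degree at most k has degree at most 2k, within the exactness 2k+1
   of the rule. *)
have size_mul (q r : {poly R}) : (size q <= k.+1 -> size r <= k.+1 ->
    size (q * r)%R <= 2 * k + 2)%N.
  by move=> sq sr; rewrite (leq_trans (size_polyMleq _ _)) //; lia.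
have sD i (u v : pwpoly m) : in_space u -> in_space v -> (size (u i + v i)%R <= k.+1)%N.
  by move=> su sv; rewrite (leq_trans (size_polyD _ _)) // geq_max su sv.
(* Every cell is tested with the same [phi]; in the sum over the cells the flux terms cancel by
   [flux]. *)
have: \sum_i (\int[lebesgue_measure]_(y in cell i)
        (((gnew i).[y] - (gold i).[y]) / tau * phi.[y])
    - \int[lebesgue_measure]_(y in cell i)
        (c * (average gnew gold i).[y] * (phi^`()).[y])
    + right_flux bc fk tau c (average gnew gold) i * phi.[edge m i.+1]
    - left_flux bc fk tau c (average gnew gold) i * phi.[edge m i]) = 0.
  by apply: big1 => i _; apply: (step i (fun=> phi)).
rewrite !big_split /= !sumrN flux addrK.
rewrite (sum_integral_quad
           (F := fun i y => ((gnew i).[y] - (gold i).[y]) / tau * phi.[y])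
           (P := fun i => (tau^-1 *: (gnew i - gold i)) * phi)); first last.
- by move=> i y; rewrite !hornerE; ring.
- move=> i; apply: size_mul => //.
  rewrite (leq_trans (size_scale_leq _ _)) // (leq_trans (size_polyD _ _)) //.
  by rewrite size_polyN geq_max snew sold.
rewrite (sum_integral_quad
           (F := fun i y => c * (average gnew gold i).[y] * phi^`().[y])
           (P := fun i => (c *: average gnew gold i) * phi^`())); first last.
- by move=> i y; rewrite !hornerE.
- move=> i; apply: size_mul.
    by rewrite !(leq_trans (size_scale_leq _ _)) // sD.
  by rewrite (leq_trans (size_poly _ _)) // (leq_trans (leq_pred _)).
rewrite (@eq_quad (fun i y => _ / tau * _) (fun i y => tau^-1 * (((gnew i).[y] - (gold i).[y]) * phi.[y]))); last first.
  by move=> i l; ring.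
rewrite (@eq_quad (fun i y => c * (average gnew gold i).[y] * _)
   (fun i y => c * ((average gnew gold i).[y] * phi^`().[y]))); last first.
  by move=> i l; rewrite mulrA.
rewrite !quadZ => /subr0_eq <-.
by rewrite mulVKf.
Qed.

(** The flux at the right end of a cell is the flux at the left end of its cyclic successor, so
    reindexing by [ordS] matches the two sums. *)
Lemma periodic_flux_sum fk tau c g :
  \sum_i right_flux Periodic fk tau c g i = \sum_i left_flux Periodic fk tau c g i.
Proof.
rewrite [RHS](reindex_inj (@ordS_inj _)); apply: eq_bigr => i _.
by rewrite /left_flux /outer_left ordSK.
Qed.

End GridQuadrature.

Lemma quad_exchange (R : realType) k (a b a' b' : R)
    (m : grid k a b) (m' : grid k a' b') w w' F :
  quad (m := m) w (fun i x => quad (m := m') w' (fun j v => F i j x v)) =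
  quad w' (fun j v => quad w (fun i x => F i j x v)).
Proof.
rewrite /quad !pair_bigA; under eq_bigr do rewrite pair_bigA mulr_sumr.
under [RHS]eq_bigr do rewrite pair_bigA mulr_sumr.
rewrite exchange_big; apply: eq_bigr => q _; apply: eq_bigr => p _.
exact: mulrCA.
Qed.

(** * Fluxes with zero exterior value in velocity *)

Lemma numflux0 (R : realType) fk (tau c : R) : numflux fk tau c 0 0 = 0.
Proof. by case: fk; rewrite /numflux /= ?subrr ?addr0 !mulr0 ?subr0. Qed.

(** Under a cyclic shift the interior terms match edge by edge. The shift also pairs the two ends of
    the interval, where [phi] may differ; there both fluxes vanish, since inner trace and exterior
    value are zero. *)
Lemma zero_exterior_flux_sum (R : realType) k (Vc : R) (mv : grid k (- Vc) Vc)
    fk (tau c : R) (g : pwpoly mv) (phi : {poly R}) :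
  zero_trace g ->
  \sum_i right_flux ZeroExterior fk tau c g i * phi.[edge mv i.+1]
    = \sum_i left_flux ZeroExterior fk tau c g i * phi.[edge mv i].
Proof.
move=> g0; rewrite [RHS](reindex_inj (@ordS_inj _)); apply: eq_bigr => i _.
rewrite /left_flux /right_flux /outer_left /outer_right ordSK /=.
have [last_i|not_last] := eqVneq i.+1 (ncells mv).
  have [_ ->//] := g0 i; have [->] := g0 (ordS i).
    by rewrite last_i modnn !numflux0 !mul0r.
  by rewrite /= last_i modnn.
have lt_i : (i.+1 < ncells mv)%N by rewrite ltn_neqAle not_last ltn_ord.
by rewrite modn_small.
Qed.

Lemma zero_trace_average (R : realType) k (Vc : R) (mv : grid k (- Vc) Vc)
    (g h : pwpoly mv) : zero_trace g -> zero_trace h -> zero_trace (average g h).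
Proof.
move=> g0 h0 j; have [gl gr] := g0 j; have [hl hr] := h0 j.
rewrite /inner_left /inner_right /average in gl gr hl hr *.
by split=> e; rewrite !hornerE ?(gl, hl, gr, hr) // addr0 mulr0.
Qed.

(** * Energy balance of the two split steps *)

Section Energy.
Variables (R : realType) (k : nat) (L Vc : R).
Variables (mx : grid k 0 L) (mv : grid k (- Vc) Vc).
Implicit Types (s : state mx mv) (f : pwpoly2 mx mv).

Lemma in_space_fix_x f i x : in_space2 f -> in_space (fix_x f i x).
Proof. by move=> fS j; have [_] := fS i j; apply/leq_trans/max_size_evalC. Qed.

Lemma in_space_fix_v f j v : in_space2 f -> in_space (fix_v f j v).
Proof.
move=> fS i; have [+ _] := fS i j.
by apply: leq_trans; rewrite -[f i j in leqRHS]swapXYK -sizeYE max_size_evalC.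
Qed.

Lemma scheme_a_admissible fk tau s s' : scheme_a fk tau s s' -> admissible s'.
Proof. by case=> g []. Qed.

Lemma scheme_b_admissible fk tau s s' : scheme_b fk tau s s' -> admissible s'.
Proof. by case=> g [Eg] [_ []]. Qed.

Variables (wx : 'I_(ncells mx) -> 'I_k.+1 -> R) (wxP : gauss_weights wx).
Variables (wv : 'I_(ncells mv) -> 'I_k.+1 -> R) (wvP : gauss_weights wv).

(** The factor v^2 raises the degree in v to at most k+2, which is within 2k+1 once k is
    positive. *)
Lemma total_energy_quad s : (0 < k)%N -> admissible s ->
  total_energy s =
  2^-1 * (quad wx (fun i x => quad wv (fun j v => (st_f s i j).[x, v] * v ^+ 2))
          + quad wx (fun i x => (st_E s i).[x] ^+ 2)).
Proof.
move=> k_gt0 [fS _ ES]; rewrite /total_energy; congr (_ * (_ + _)).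
(* Stated at every [x], since it is used under the integral in x. *)
- have inner i x : integral_over (fun j v => (st_f s i j).[x, v] * `|v| ^+ 2) =
      quad wv (fun j v => (st_f s i j).[x, v] * v ^+ 2).
    rewrite /integral_over (sum_integral_quad wvP
      (F := fun j v => (st_f s i j).[x, v] * `|v| ^+ 2)
      (P := fun j => (st_f s i j).[x%:P] * 'X^2)).
    + by apply: eq_quad => j m; rewrite real_normK ?num_real.
    + move=> j; rewrite (leq_trans (size_polyMleq _ _)) // size_polyXn.
      by have := in_space_fix_x i x fS j; rewrite /fix_x; lia.
    + by move=> j v; rewrite hornerM hornerXn real_normK ?num_real.
  under eq_fun do under eq_fun do rewrite inner.
  (* With the v-integral turned into a finite sum, the integrand is a combination of slices at the
     velocity nodes, hence of degree at most k in x. *)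
  apply: (sum_integral_quad wxP
    (P := fun i => \sum_j \sum_m (wv j m * node mv j m ^+ 2)
                     *: fix_v (st_f s) j (node mv j m) i)).
  + move=> i; do 2![apply: (leq_trans (size_sum _ _ _)); apply/bigmax_leqP => ? _].
    rewrite (leq_trans (size_scale_leq _ _)) //.
    by rewrite (leq_trans (in_space_fix_v _ _ fS _)) //; lia.
  + move=> i x; rewrite horner_sum; apply: eq_bigr => j _.
    rewrite horner_sum; apply: eq_bigr => m _.
    by rewrite hornerZ /fix_v horner2_swapXY -mulrA [_ * (st_f _ _ _).[_, _]]mulrC.
- apply: etrans (_ : quad wx (fun i x => `|(st_E s i).[x]| ^+ 2) = _).
    apply: (sum_integral_quad wxP (P := fun i => st_E s i ^+ 2)) => [i|i x].
      by rewrite expr2 (leq_trans (size_polyMleq _ _)) //; have := ES i; lia.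
    by rewrite horner_exp real_normK ?num_real.
  by apply: eq_quad => i l; rewrite real_normK ?num_real.
Qed.

Lemma scheme_a_energy fk tau s s' : (0 < k)%N -> tau != 0 -> admissible s ->
  scheme_a fk tau s s' -> total_energy s' = total_energy s.
Proof.
move=> k_gt0 tau0 sA ss'; rewrite !total_energy_quad //; last exact: scheme_a_admissible ss'.
case: sA ss' => fS _ _ [g [gS step _ f'E ->]]; congr (_ * (_ + _)).
have mass j m : quad wx (fun i x => (g j m i).[x]) =
                quad wx (fun i x => (st_f s i j).[x, node mv j m]).
  have /(_ 1) := @dg_step_quad _ _ _ _ _ _ wxP _ _ _ _ _ _ _ tau0
    (in_space_fix_v j (node mv j m) fS) (gS j m) _ (step j m).
  rewrite size_poly1 => /(_ isT).
  under eq_bigr do rewrite hornerC mulr1.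
  under [in X in _ = X -> _]eq_bigr do rewrite hornerC mulr1.
  move=> /(_ (periodic_flux_sum _ _ _ _)).
  rewrite (eq_quad _ (G := fun i y => (g j m i).[y] + (-1) * (st_f s i j).[y, node mv j m])).
    rewrite quadD quadZ mulN1r.
    (* The derivative of the test function 1 is zero; writing the integrand as [0 * 0] lets [quadZ]
       pull out a zero factor. *)
    rewrite (eq_quad wx (F := fun i y => _ * _) (G := fun i y => 0 * 0)) => [|i l].
      by rewrite (quadZ wx 0 (fun _ _ => 0)) mul0r !mulr0 => /subr0_eq.
    by rewrite derivC hornerC mulr0 mul0r.
  by move=> i l; rewrite hornerC mulr1 mulN1r /fix_v horner2_swapXY.
(* With the x-sum inside, v^2 is a constant factor and [mass] applies. *)
rewrite [LHS]quad_exchange [RHS]quad_exchange; apply: eq_quad => j m.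
rewrite (eq_quad wx (G := fun i x => node mv j m ^+ 2 * (g j m i).[x])).
  rewrite quadZ mass -quadZ; apply: eq_quad => i l; exact: mulrC.
by move=> i l; rewrite f'E mulrC.
Qed.

Lemma scheme_b_energy fk tau s s' : (2 <= k)%N -> tau != 0 -> admissible s ->
  scheme_b fk tau s s' -> total_energy s' = total_energy s.
Proof.
move=> k_ge2 tau0 sA ss'.
rewrite !total_energy_quad ?(ltnW k_ge2) //; last exact: scheme_b_admissible ss'.
case: sA ss' => fS f0 _ [g [Eg [step [_ f'E E'E]]]]; congr (_ * _).
(* The balance holds at each node in x separately, so the two energies are compared node by node. *)
rewrite -!quadD; apply: eq_quad => i l; rewrite E'E.
have [gS g0 dg amp] := step i l.
set x := node mx i l in dg amp *.
set E := (st_E s i).[x] in dg amp *; set E' := Eg i l in dg amp *.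
have current_quad (h : pwpoly mv) :
    in_space h -> current h = quad wv (fun j v => (h j).[v] * v).
  move=> hS; apply: (sum_integral_quad wvP (P := fun j => h j * 'X)) => [j|j v].
    by rewrite (leq_trans (size_polyMleq _ _)) // size_polyX; have := hS j; lia.
  by rewrite hornerM hornerX.
have energy := @dg_step_quad _ _ _ _ _ _ wvP _ _ _ _ _ _ 'X^2 tau0
    (in_space_fix_x i x fS) gS _ dg
    (zero_exterior_flux_sum _ _ _ _ (zero_trace_average g0 (f0 i x (cell_node i l)))).
move: energy; rewrite size_polyXn => /(_ k_ge2).
rewrite (eq_quad _ (G := fun j v => (g i l j).[v] * v ^+ 2
                          + (-1) * ((st_f s i j).[x, v] * v ^+ 2))); last first.
  by move=> j m; rewrite hornerXn /fix_x; ring.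
rewrite quadD quadZ.
(* The derivative 2v absorbs the factor 1/2 of the average, leaving the sum of the two current
   integrands. *)
rewrite (eq_quad wv (F := fun j v => (average _ _ j).[v] * _)
                    (G := fun j v => (g i l j).[v] * v
                          + (fix_x (st_f s) i x j).[v] * v)); last first.
  move=> j m; rewrite derivXn hornerMn hornerXn /average hornerZ hornerD.
  by field.
rewrite quadD -!current_quad //; last exact: in_space_fix_x.
rewrite (eq_quad wv (F := fun j v => (st_f s' i j).[x, v] * _)
                    (G := fun j v => (g i l j).[v] * v ^+ 2)); last first.
  by move=> j m; rewrite /x f'E.
move/(canRL (divfK tau0)) in amp; move=> energy.
(* The Ampère equation times E' + E: its right-hand side is the opposite of the kinetic gain in
   [energy], because the speed there is the mean of E and E'. *)
have : (E' - E) * (E' + E) = - (2^-1 * (current (fix_x (st_f s) i x)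
    + current (g i l))) * tau * (E' + E) by rewrite amp.
by lra.
Qed.

End Energy.

(** * Composition of the split steps *)

Lemma beta1_gt (R : realType) : 2 / 3 < beta1 R.
Proof.
rewrite /beta1; have a0 := powR_gt0 3^-1 (ltr0n R 2).
by have := powR_gt0 (- 3^-1) (ltr0n R 2); lra.
Qed.

Section Invariance.
Variables (R : realType) (k : nat) (L Vc : R).
Variables (mx : grid k 0 L) (mv : grid k (- Vc) Vc).

Lemma scheme4_energy fkx fkv tau (s s' : state mx mv) :
  (2 <= k)%N -> tau != 0 -> admissible s -> scheme4 fkx fkv tau s s' ->
  admissible s' /\ total_energy s' = total_energy s.
Proof.
move=> k_ge2 tau0 sA [s1 [s2 [a1 b2 a3]]].
have k_gt0 := ltnW k_ge2.
have [wx wxP] := gauss_weights_exist mx; have [wv wvP] := gauss_weights_exist mv.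
have s1A := scheme_a_admissible a1; have s2A := scheme_b_admissible b2.
have half0 : tau / 2 != 0 by rewrite mulf_neq0 // invr_neq0 ?pnatr_eq0.
split; first exact: scheme_a_admissible a3.
by rewrite (scheme_a_energy wxP wvP _ _ _ a3) // (scheme_b_energy wxP wvP _ _ _ b2) //
  (scheme_a_energy wxP wvP _ _ _ a1).
Qed.

Lemma scheme4F_energy fkx fkv tau (s s' : state mx mv) :
  (2 <= k)%N -> tau != 0 -> admissible s -> scheme4F fkx fkv tau s s' ->
  admissible s' /\ total_energy s' = total_energy s.
Proof.
move=> k_ge2 tau0 sA [s1 [s2 [t1 t2 t3]]]; have b1 := @beta1_gt R.
have step1 : beta1 R * tau != 0 by rewrite mulf_neq0 // gt_eqF //; lra.
(* As [beta1 R] exceeds 2/3, [beta2 R] is below -1/3: the middle substep reverses the sign of [tau]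
   but has nonzero length. *)
have step2 : beta2 R * tau != 0.
  by rewrite mulf_neq0 // lt_eqF // /beta2; lra.
have [s1A <-] := scheme4_energy k_ge2 step1 sA t1.
have [s2A <-] := scheme4_energy k_ge2 step2 s1A t2.
exact: scheme4_energy k_ge2 step1 s2A t3.
Qed.

End Invariance.

Theorem theorem3p9 (R : realType) (k : nat) (L Vc : R)
    (mx : grid k 0 L) (mv : grid k (- Vc) Vc) (fkx fkv : flux_kind)
    (dt : R) (s : nat -> state mx mv) :
  0 < L -> 0 < Vc -> (2 <= k)%N -> 0 < dt ->
  admissible (s 0%N) ->
  (forall n, scheme4 fkx fkv dt (s n) (s n.+1)) \/
  (forall n, scheme4F fkx fkv dt (s n) (s n.+1)) ->
  forall n, total_energy (s n) = total_energy (s n.+1).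
Proof.
move=> _ _ k_ge2 /lt0r_neq0 dt0 s0A scheme n.
have step i : admissible (s i) ->
    admissible (s i.+1) /\ total_energy (s i.+1) = total_energy (s i).
  by case: scheme => /(_ i) si sA;
    [apply: scheme4_energy si | apply: scheme4F_energy si].
(* Each step returns an admissible state, so admissibility spreads from the initial state to the
   whole sequence. *)
have sA i : admissible (s i) by elim: i => // i /step[].
by have [_ ->] := step n (sA n).
Qed.
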